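(* Let $H$ be a real Hilbert space, let $\mathcal D\subset H$ be a dictionary, let $\{t_k\}_{k=1}^\infty$ be a sequence with $t_k\in(0,1]$ for all $k$, and let $f\in\mathcal A_1(\mathcal D)\subset H$. Then every output $(f_m)_{m\ge 0}$ of the Weak Rescaled Pure Greedy Algorithm WRPGA($\{t_k\},\mathcal D$) applied to $f$ satisfies $$\|f-f_m\|\le |f|_{\mathcal A_1(\mathcal D)}\left(\sum_{k=1}^m t_k^2\right)^{-1/2},\qquad m\ge1.$$
   Context: $H$ is a real Hilbert space with inner product $\langle\cdot,\cdot\rangle$ and norm $\|f\|=\langle f,f\rangle^{1/2}$. Dictionary: a set $\mathcal D\subset H$ with $\|\varphi\|=1$ for every $\varphi\in\mathcal D$ such that the closure of $\mathrm{span}(\mathcal D)$ is $H$. For $M>0$ let $\mathcal A_1^{o}(\mathcal D,M)$ be the set of all finite sums $\sum_{k\in\Lambda}c_k\varphi_k$ with $\varphi_k\in\mathcal D$, $|\Lambda|<\infty$ and $\sum_{k\in\Lambda}|c_k|\le M$, and let $\mathcal A_1(\mathcal D,M)$ be its closure in $H$. Put $\mathcal A_1(\mathcal D)=\bigcup_{M>0}\mathcal A_1(\mathcal D,M)$ and, for $f\in\mathcal A_1(\mathcal D)$, $|f|_{\mathcal A_1(\mathcal D)}=\inf\{M: f\in\mathcal A_1(\mathcal D,M)\}$. WRPGA($\{t_k\},\mathcal D$) applied to $f$ produces a sequence $(f_m)_{m\ge0}$ as follows. Step 0: $f_0:=0$. Step $m\ge1$: if $f_{m-1}=f$, the algorithm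 stops and $f_k:=f$ for all $k\ge m$. If $f_{m-1}\ne f$, choose $\varphi_m\in\mathcal D$ such that $$|\langle f-f_{m-1},\varphi_m\rangle|\ge t_m\sup_{\varphi\in\mathcal D}|\langle f-f_{m-1},\varphi\rangle|$$ (it is assumed that such a choice exists at each step; it need not be unique), and set $$\lambda_m:=\langle f-f_{m-1},\varphi_m\rangle,\quad \hat f_m:=f_{m-1}+\lambda_m\varphi_m,\quad s_m:=\frac{\langle f,\hat f_m\rangle}{\|\hat f_m\|^2},\quad f_m:=s_m\hat f_m .$$ *)

(* Defs.v *)
From HB Require Import structures.
From mathcomp Require Import all_boot all_order all_algebra.
From mathcomp Require Import all_classical all_reals all_analysis.
Set Implicit Arguments.
Unset Strict Implicit.
Unset Printing Implicit Defensive.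
Import Order.TTheory GRing.Theory Num.Theory.
Import numFieldNormedType.Exports.
Local Open Scope classical_set_scope.
Local Open Scope ring_scope.

(* A real Hilbert space is a completeNormedModType H over a realType together
   with a positive definite symmetric form dot : {dot H for idfun} inducing the
   norm of H. *)
Definition induces_norm (R : realType) (H : completeNormedModType R)
    (dot : {dot H for idfun}) : Prop :=
  forall u : H, `|u| = Num.sqrt (dot u u).

Definition linear_span (R : realType) (H : completeNormedModType R)
    (D : set H) : set H :=
  [set x | exists (n : nat) (c : 'I_n -> R) (phi : 'I_n -> H),
      (forall k, D (phi k)) /\ x = \sum_(k < n) c k *: phi k].

Definition dictionary (R : realType) (H : completeNormedModType R)
    (D : set H) : Prop :=
  (forall phi, D phi -> `|phi| = 1) /\ closure (linear_span D) = setT.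

Definition A1o (R : realType) (H : completeNormedModType R)
    (D : set H) (M : R) : set H :=
  [set x | exists (n : nat) (c : 'I_n -> R) (phi : 'I_n -> H),
      [/\ forall k, D (phi k), x = \sum_(k < n) c k *: phi k
        & \sum_(k < n) `|c k| <= M]].

Definition A1M (R : realType) (H : completeNormedModType R)
    (D : set H) (M : R) : set H :=
  closure (A1o D M).

Definition A1 (R : realType) (H : completeNormedModType R)
    (D : set H) : set H :=
  \bigcup_(M in [set M : R | 0 < M]) A1M D M.

(* inf is only meaningful for f in A1 D; it is 0 otherwise. *)
Definition A1norm (R : realType) (H : completeNormedModType R)
    (D : set H) (f : H) : R :=
  inf [set M : R | 0 < M /\ A1M D M f].

(* g and g' are consecutive iterates: phi is the chosen dictionary element and
   tm the weakness parameter. The supremum is that of a nonempty bounded set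
   (D phi and Cauchy-Schwarz), so the real-valued sup is the genuine one. *)
Definition wrpga_step (R : realType) (H : completeNormedModType R)
    (dot : {dot H for idfun}) (D : set H) (tm : R) (f g g' : H) : Prop :=
  exists phi : H,
    [/\ D phi,
        `|dot (f - g) phi| >= tm * sup [set `|dot (f - g) psi| | psi in D]
      & let lambda := dot (f - g) phi in
        let fhat := g + lambda *: phi in
        let s := dot f fhat / `|fhat| ^+ 2 in
        g' = s *: fhat].

(* The weakness sequence is indexed from 1; t 0 is never used. *)
Definition wrpga_output (R : realType) (H : completeNormedModType R)
    (dot : {dot H for idfun}) (D : set H) (t : nat -> R) (f : H)
    (fs : nat -> H) : Prop :=
  fs 0%N = 0 /\
  forall m : nat, (1 <= m)%N ->
    (fs m.-1 = f -> forall k : nat, (m <= k)%N -> fs k = f) /\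
    (fs m.-1 <> f -> wrpga_step dot D (t m) f (fs m.-1) (fs m)).

(* Main.v *)
Require Import Defs.
From HB Require Import structures.
From mathcomp Require Import all_boot all_order all_algebra.
From mathcomp Require Import all_classical all_reals all_analysis.
From mathcomp Require Import ring lra.
Set Implicit Arguments.
Unset Strict Implicit.
Unset Printing Implicit Defensive.
Import Order.TTheory GRing.Theory Num.Theory.
Import numFieldNormedType.Exports.
Local Open Scope classical_set_scope.
Local Open Scope ring_scope.

(* Let [a m] be the squared error at step [m]. Rescaling makes [fs m] the
   orthogonal projection of [f] onto a line, so that [a m] is at most the squared
   error before rescaling, [a m.-1 - lambda ^+ 2], and [f - fs m] is orthogonal
   to [fs m]. The latter gives [a m.-1 = dot (f - fs m.-1) f <= M * sup],
   whenever [f] is in [A1M D M], hence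
   [a m <= a m.-1 * (1 - t m ^+ 2 * a m.-1 / M ^+ 2)], a recursion under which
   [M ^+ 2 / a m] grows by at least [t m ^+ 2] at each step. *)

Lemma dotC (R : realType) (H : completeNormedModType R)
    (dot : {dot H for idfun}) (u v : H) : dot u v = dot v u.
Proof. by rewrite hermC /= expr0 mul1r. Qed.

Lemma dotZl (R : realType) (H : completeNormedModType R)
    (dot : {dot H for idfun}) (a : R) (u v : H) :
  dot (a *: u) v = a * dot u v.
Proof. by rewrite linearZl_LR. Qed.

Lemma dotZr (R : realType) (H : completeNormedModType R)
    (dot : {dot H for idfun}) (a : R) (u v : H) :
  dot u (a *: v) = a * dot u v.
Proof. by rewrite linearZr_LR. Qed.

Lemma dot_normE (R : realType) (H : completeNormedModType R)
    (dot : {dot H for idfun}) (dot_norm : induces_norm dot) (u : H) :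
  dot u u = `|u| ^+ 2.
Proof.
rewrite dot_norm sqr_sqrtr //.
by have [->|u0] := eqVneq u 0; [rewrite linear0r | exact/ltW/neq0_dnorm_gt0].
Qed.

Lemma normsqBZ (R : realType) (H : completeNormedModType R)
    (dot : {dot H for idfun}) (dot_norm : induces_norm dot)
    (u v : H) (a : R) :
  `|u - a *: v| ^+ 2 = `|u| ^+ 2 - 2 * a * dot u v + a ^+ 2 * `|v| ^+ 2.
Proof.
rewrite -!(dot_normE dot_norm) linearBl linearBr linearBr /= !dotZl !dotZr.
by rewrite (dotC dot v u); ring.
Qed.

Lemma cauchy_schwarz (R : realType) (H : completeNormedModType R)
    (dot : {dot H for idfun}) (dot_norm : induces_norm dot) (u v : H) :
  `|dot u v| <= `|u| * `|v|.
Proof.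
have [->|v0] := eqVneq v 0; first by rewrite linear0r !normr0 mulr0.
have q0 : 0 < `|v| ^+ 2 by rewrite exprn_gt0 // normr_gt0.
rewrite -(@ler_pXn2r _ 2) ?nnegrE ?mulr_ge0 // real_normK ?num_real //.
rewrite exprMn -subr_ge0.
(* The vector is the residual of projecting [u] onto the line of [v]. *)
have := sqr_ge0 `|u - (dot u v / `|v| ^+ 2) *: v|.
rewrite (normsqBZ dot_norm) => h; rewrite -(pmulr_lge0 _ q0) in h.
apply: le_trans h _.
by rewrite le_eqVlt; apply/orP; left; apply/eqP; field; rewrite normr_eq0.
Qed.

Lemma rescale_orthogonal (R : realType) (H : completeNormedModType R)
    (dot : {dot H for idfun}) (dot_norm : induces_norm dot) (f h : H) :
  let g := (dot f h / `|h| ^+ 2) *: h in dot (f - g) g = 0.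
Proof.
have [->|h0] /= := eqVneq h 0; first by rewrite scaler0 linear0r.
rewrite linearBl /= dotZl !dotZr (dot_normE dot_norm).
by field; rewrite normr_eq0.
Qed.

(** With [p = dot f h] and [q = dot h h], the gap between the two sides is the square
    [(q - p) ^+ 2 / q]. *)
Lemma rescale_optimal (R : realType) (H : completeNormedModType R)
    (dot : {dot H for idfun}) (dot_norm : induces_norm dot) (f h : H) :
  `|f - (dot f h / `|h| ^+ 2) *: h| ^+ 2 <= `|f - h| ^+ 2.
Proof.
have [->|h0] := eqVneq h 0; first by rewrite scaler0.
have q0 : 0 < `|h| ^+ 2 by rewrite exprn_gt0 // normr_gt0.
rewrite -{4}[h]scale1r !(normsqBZ dot_norm) -subr_ge0.
have -> : forall a p q : R, q != 0 ->
    a - 2 * 1 * p + 1 ^+ 2 * q - (a - 2 * (p / q) * p + (p / q) ^+ 2 * q)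
    = (q - p) ^+ 2 / q by move=> a p q qN0; field.
  by rewrite divr_ge0 ?sqr_ge0 // ltW.
by rewrite gt_eqF.
Qed.

(** Dictionary elements are unit vectors, so Cauchy-Schwarz bounds all correlations by the norm of
    [u], which makes the real [sup] a true upper bound. *)
Lemma dictionary_correlation_le_sup (R : realType)
    (H : completeNormedModType R)
    (dot : {dot H for idfun}) (dot_norm : induces_norm dot)
    (D : set H) (dictD : dictionary D) (u psi : H) (Dpsi : D psi) :
  `|dot u psi| <= sup [set `|dot u xi| | xi in D].
Proof.
apply: ub_le_sup; last by exists psi.
exists `|u| => _ [xi Dxi <-].
by rewrite (le_trans (cauchy_schwarz dot_norm u xi)) // (dictD.1 _ Dxi) mulr1.
Qed.

(** On finite sums the bound holds term by term; it passes to the closure because [dot u] is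
    continuous. The element [phi] serves to show that the supremum is nonnegative. *)
Lemma dot_A1M_le (R : realType) (H : completeNormedModType R)
    (dot : {dot H for idfun}) (dot_norm : induces_norm dot)
    (D : set H) (dictD : dictionary D) (M : R) (f u phi : H)
    (A1Mf : A1M D M f) (Dphi : D phi) :
  dot u f <= M * sup [set `|dot u psi| | psi in D].
Proof.
set S := sup _.
have leS psi : D psi -> `|dot u psi| <= S.
  exact: dictionary_correlation_le_sup.
have S0 : 0 <= S by exact: le_trans (leS _ Dphi).
have leA x : A1o D M x -> dot u x <= M * S.
  move=> [n [c [xi [Dxi -> cM]]]].
  rewrite linear_sumr /=; apply: (@le_trans _ _ (\sum_(k < n) `|c k| * S)).
    apply: ler_sum => k _; rewrite dotZr.
    by rewrite (le_trans (ler_norm _)) // normrM ler_wpM2l // leS.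
  by rewrite -mulr_suml ler_wpM2r.
apply/ler_addgt0Pr => e e0.
(* Moving from [f] to a finite sum within this radius changes [dot u f] by at most [e]; the added 1
   keeps the radius positive when [u = 0]. *)
have d0 : 0 < e / (`|u| + 1) by rewrite divr_gt0 // ltr_wpDl.
have [x [Ax]] := A1Mf _ (nbhsx_ballx f _ d0).
rewrite -ball_normE /= => fx.
rewrite -[f](subrK x) linearDr addrC lerD ?leA //.
rewrite (le_trans (ler_norm _)) // (le_trans (cauchy_schwarz dot_norm _ _)) //.
apply: (@le_trans _ _ ((`|u| + 1) * (e / (`|u| + 1)))).
  by rewrite ler_pM // ?lerDl // ltW.
by rewrite mulrC divfK // gt_eqF // ltr_wpDl.
Qed.

Lemma wrpga_step_orthogonal (R : realType) (H : completeNormedModType R)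
    (dot : {dot H for idfun}) (dot_norm : induces_norm dot)
    (D : set H) (tm : R) (f g g' : H) (st : wrpga_step dot D tm f g g') :
  dot (f - g') g' = 0.
Proof. by case: st => phi [_ _ ->]; exact: rescale_orthogonal. Qed.

Lemma wrpga_step_decrease (R : realType) (H : completeNormedModType R)
    (dot : {dot H for idfun}) (dot_norm : induces_norm dot)
    (D : set H) (dictD : dictionary D) (tm M : R) (f g g' : H)
    (tm0 : 0 <= tm) (M0 : 0 < M) (A1Mf : A1M D M f)
    (og : dot (f - g) g = 0) (st : wrpga_step dot D tm f g g') :
  `|f - g'| ^+ 2 <=
  `|f - g| ^+ 2 * (1 - tm ^+ 2 * (`|f - g| ^+ 2 / M ^+ 2)).
Proof.
case: st => phi [Dphi]; set l := dot _ phi; set S := sup _ => lS -> /=.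
apply: le_trans (rescale_optimal dot_norm _ _) _.
rewrite opprD addrA (normsqBZ dot_norm) -/l (dictD.1 _ Dphi).
move: (`|f - g| ^+ 2) (dot_normE dot_norm (f - g)) => a aE.
have aS : a <= M * S.
  rewrite (le_trans _ (dot_A1M_le dot_norm dictD _ A1Mf Dphi)) //.
  by rewrite -aE linearBr /= og subr0.
have a0 : 0 <= a by rewrite -aE (dot_normE dot_norm) sqr_ge0.
have tl : tm * (a / M) <= `|l|.
  by rewrite (le_trans _ lS) // ler_wpM2l // ler_pdivrMr // mulrC.
have : (tm * (a / M)) ^+ 2 <= l ^+ 2.
  rewrite -(real_normK (num_real l)) ler_pXn2r ?nnegrE ?mulr_ge0 //.
  by rewrite invr_ge0 ltW.
rewrite 2!exprMn exprVn; set i := (M ^+ 2)^-1; nra.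
Qed.

(* For [x > 0] and [b * x < 1] this says that [1 / x >= s] and
   [y <= x * (1 - b * x)] give [1 / y >= s + b]; it is stated without division
   because the error may vanish. *)
Lemma decrease_sum_bound (R : realType) (x y s b : R) (x0 : 0 <= x)
    (y0 : 0 <= y) (s0 : 0 <= s) (b0 : 0 <= b) (xs : x * s <= 1)
    (yx : y <= x * (1 - b * x)) :
  y * (s + b) <= 1.
Proof.
have [bx|bx] := leP (b * x) 1.
  apply: (@le_trans _ _ ((1 - b * x) * (x * s + x * b))).
    by rewrite -mulrDr (mulrA (1 - _)) (mulrC _ x) ler_wpM2r // addr_ge0.
  apply: (@le_trans _ _ ((1 - b * x) * (1 + x * b))).
    by rewrite ler_wpM2l ?subr_ge0 // lerD2r.
  rewrite (_ : _ * _ = 1 - (x * b) ^+ 2); last by ring.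
  by rewrite gerBl sqr_ge0.
(* Once [b * x] exceeds 1, the recursion forces [y] to vanish. *)
have : y <= 0 by rewrite (le_trans yx) // mulr_ge0_le0 // subr_le0 ltW.
move=> y_le0; have -> : y = 0 by apply/le_anti; rewrite y_le0.
by rewrite mul0r.
Qed.

(** Orthogonality is carried through the induction because the decrease at the next step relies on
    it. *)
Lemma wrpga_energy_bound (R : realType) (H : completeNormedModType R)
    (dot : {dot H for idfun}) (dot_norm : induces_norm dot)
    (D : set H) (dictD : dictionary D)
    (t : nat -> R) (t_ge0 : forall k : nat, (1 <= k)%N -> 0 <= t k)
    (f : H) (fs : nat -> H) (fs_out : wrpga_output dot D t f fs)
    (M : R) (M0 : 0 < M) (A1Mf : A1M D M f) (m : nat) :
  dot (f - fs m) (fs m) = 0 /\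
  `|f - fs m| ^+ 2 / M ^+ 2 * \sum_(1 <= k < m.+1) t k ^+ 2 <= 1.
Proof.
have [fs0 fsS] := fs_out.
elim: m => [|m [og IH]].
  by rewrite fs0 linear0r big_geq // mulr0.
have [stop next] := fsS m.+1 isT.
(* If the algorithm has stopped, the error is zero and both claims are trivial. *)
have [/stop -> //|/next st] := pselect (fs m = f).
  by rewrite subrr linear0l normr0 expr0n !mul0r.
split; first exact: wrpga_step_orthogonal st.
have M2 : 0 < M ^+ 2 by exact: exprn_gt0.
rewrite big_nat_recr //=.
apply: decrease_sum_bound IH _; rewrite ?divr_ge0 ?sqr_ge0 //.
  by apply: sumr_ge0 => k _; exact: sqr_ge0.
rewrite ler_pdivrMr // mulrAC divfK ?gt_eqF //.
exact: (wrpga_step_decrease dot_norm dictD (t_ge0 _ _) M0 A1Mf og st).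
Qed.

Theorem theorem4p1 (R : realType) (H : completeNormedModType R)
    (dot : {dot H for idfun}) (dot_norm : induces_norm dot)
    (D : set H) (dictD : dictionary D)
    (t : nat -> R) (t01 : forall k : nat, (1 <= k)%N -> 0 < t k <= 1)
    (f : H) (A1f : A1 D f)
    (fs : nat -> H) (fs_out : wrpga_output dot D t f fs)
    (m : nat) (m_ge1 : (1 <= m)%N) :
  `|f - fs m| <= A1norm D f * (\sum_(1 <= k < m.+1) t k ^+ 2) `^ (- 2^-1).
Proof.
have t0 k : (1 <= k)%N -> 0 <= t k by move=> /t01/andP[/ltW].
set S := \sum_(1 <= k < _) _.
have S0 : 0 < S.
  (* Since [m >= 1], the sum contains the positive term [t 1 ^+ 2]. *)
  rewrite /S big_nat_recl // ltr_pwDl //; last first.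
    by apply: sumr_ge0 => k _; exact: sqr_ge0.
  by rewrite exprn_gt0 //; case/andP: (t01 1%N isT).
rewrite powRN powR12_sqrt ?(ltW S0) //.
rewrite ler_pdivlMr ?sqrtr_gt0 //.
(* With the infimum alone on the right, it suffices to bound every admissible [M] from below, so
   attainment of the infimum is not at issue. *)
apply: lb_le_inf.
  by have [M M0 A1Mf] := A1f; exists M.
move=> M [M0 A1Mf].
have [_] := wrpga_energy_bound dot_norm dictD t0 fs_out M0 A1Mf m.
rewrite -/S mulrAC ler_pdivrMr ?exprn_gt0 // mul1r => le2.
rewrite -(@ler_pXn2r _ 2) ?nnegrE ?mulr_ge0 ?sqrtr_ge0 ?(ltW M0) //.
by rewrite exprMn sqr_sqrtr ?(ltW S0).
Qed.
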